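(* For a binary string $x$ of length $n$ drawn uniformly at random from $\{0,1\}^n$, the expected number of bit comparisons made by algorithm Tournament on $x$ is at most $2n/3 + O(\sqrt{n\log n})$.
   Context: The majority bit of $x=x_1\cdots x_n\in\{0,1\}^n$ is the bit appearing more than $\lfloor n/2\rfloor$ times; if none exists, ''no majority'' must be reported. A comparison tests whether two bits $x_i,x_j$ are equal. Algorithm Tournament$(x_1\cdots x_n)$: if $n=1$ return $x_1$; if $n=2$, return $x_1$ if $x_1=x_2$ and otherwise ''no majority''; if $n=3$, return $x_1$ if $x_1=x_2$ and otherwise return $x_3$; otherwise let $y$ be the empty string, for $i=1,\ldots,\lfloor n/2\rfloor$ compare $x_{2i-1}$ with $x_{2i}$ and if they are equal append $x_{2i}$ to $y$; if $\lfloor n/2\rfloor$ is even, append $x_n$ to $y$; then return Tournament$(y)$. *)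

(* Defs.v *)
From HB Require Import structures.
From mathcomp Require Import all_boot all_order all_algebra.
From mathcomp Require Import all_classical all_reals all_analysis.

Set Implicit Arguments.
Unset Strict Implicit.
Unset Printing Implicit Defensive.

Import Order.TTheory GRing.Theory Num.Theory.
Local Open Scope ring_scope.

(* The algorithms below return their output paired with the number of bit
   comparisons made, each test [a == b] of two input bits counting for one. *)

Fixpoint pair_round (x : seq bool) : seq bool * nat :=
  if x is a :: b :: x' then
    let: (y, c) := pair_round x' in
    (if a == b then b :: y else y, c.+1)
  else ([::], 0%N).

(* The output [None] means "no majority". The empty string, which does occur in
   recursive calls (every pair may be discarded), has no majority bit and costs
   no comparison. [k] bounds the recursion depth; the cutoff at [k = 0] is never
   reached on a nonempty string when [size x <= k], see [tournamentE]. *)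
Fixpoint tournament_rec (k : nat) (x : seq bool) : option bool * nat :=
  if k isn't k'.+1 then (None, 0%N) else
  match x with
  | [::] => (None, 0%N)
  | [:: x1] => (Some x1, 0%N)
  | [:: x1; x2] => (if x1 == x2 then Some x1 else None, 1%N)
  | [:: x1; x2; x3] => (if x1 == x2 then Some x1 else Some x3, 1%N)
  | x1 :: _ =>
      let: (y, c) := pair_round x in
      let y' := if odd (size x)./2 then y else rcons y (last x1 x) in
      let: (r, d) := tournament_rec k' y' in
      (r, c + d)%N
  end.

Definition tournament (x : seq bool) : option bool * nat :=
  tournament_rec (size x) x.

Definition comparisons (x : seq bool) : nat := (tournament x).2.

Definition expected_comparisons (R : realType) (n : nat) : R :=
  (\sum_(x : n.-tuple bool) (comparisons x)%:R) / (2 ^ n)%:R.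

Lemma pair_round_size (x : seq bool) :
  (size (pair_round x).1 <= (size x)./2)%N.
Proof.
have [m] := ubnP (size x); elim: m x => // m IHm [|a [|b x]] //= ltm.
have /IHm : (size x < m)%N by rewrite -ltnS; exact: ltnW.
by case: (pair_round x) => y c /=; case: ifP => //= _; apply: leqW.
Qed.

Lemma pair_round_count (x : seq bool) : (pair_round x).2 = (size x)./2.
Proof.
have [m] := ubnP (size x); elim: m x => // m IHm [|a [|b x]] //= ltm.
have /IHm : (size x < m)%N by rewrite -ltnS; exact: ltnW.
by case: (pair_round x) => y c /= ->.
Qed.

Lemma pair_round_next_size (x : seq bool) (b : bool) : (3 < size x)%N ->
  (size (if odd (size x)./2 then (pair_round x).1
         else rcons (pair_round x).1 b) < size x)%N.
Proof.
move=> x4; have le := pair_round_size x.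
have lt : ((size x)./2.+1 < size x)%N.
  by case: (size x) x4 => [|[|[|[|n]]]] //= _; rewrite !ltnS leq_half_double -addnn;
     rewrite -addnS leq_addr.
by case: ifP => _; rewrite ?size_rcons; apply: leq_ltn_trans lt => //;
   apply: leqW.
Qed.

Lemma tournament_recS (k : nat) (x : seq bool) : (3 < size x)%N ->
  tournament_rec k.+1 x =
    let: (y, c) := pair_round x in
    let y' := if odd (size x)./2 then y else rcons y (last false x) in
    let: (r, d) := tournament_rec k y' in
    (r, c + d)%N.
Proof. by case: x => [|x1 [|x2 [|x3 [|x4 x]]]]. Qed.

Lemma tournament_rec_enough (k l : nat) (x : seq bool) :
  (size x <= k)%N -> (size x <= l)%N -> tournament_rec k x = tournament_rec l x.
Proof.
elim: k l x => [|k IHk] [|l] x; rewrite ?leqn0.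
- by [].
- by move=> /nilP ->.
- by move=> _ /nilP ->.
have [x4|] := ltnP 3 (size x); last by case: x => [|x1 [|x2 [|x3 [|x4 x]]]].
move=> hk hl; rewrite !tournament_recS //.
have := pair_round_next_size (last false x) x4.
case: (pair_round x) => y c /= lt.
by rewrite (IHk l) // -ltnS; apply: leq_trans lt _.
Qed.

(* The recursion equation of the algorithm, showing that the depth bound is not
   observable. *)
Lemma tournamentE (x : seq bool) : (3 < size x)%N ->
  tournament x =
    let: (y, c) := pair_round x in
    let y' := if odd (size x)./2 then y else rcons y (last false x) in
    let: (r, d) := tournament y' in
    (r, c + d)%N.
Proof.
move=> x4; have := pair_round_next_size (last false x) x4.
have [k sx] : exists k, size x = k.+1 by case: (size x) x4 => // k; exists k.
rewrite /tournament [in LHS]sx tournament_recS //.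
case: (pair_round x) => y c /= lt.
rewrite (@tournament_rec_enough k (size
  (if odd (size x)./2 then y else rcons y (last false x)))) //.
by rewrite -ltnS -sx.
Qed.

(* Main.v *)
(* If the size-[n] input consists of a uniform prefix followed by at most two fixed
   bits, a round costs n/2 + O(1) comparisons and its output has the same shape,
   with a uniform prefix of random length J of mean about n/4. Since
   n/2 + (2/3)(n/4) = 2n/3, the linear part of the bound reproduces itself. For
   the remainder 2 sqrt n + 1, the function sqrt is replaced by a tangent line, so
   that only the mean of J is needed, and 2 sqrt(n/4) = sqrt n leaves room to pay
   for the O(1). *)

Require Import Defs.
From mathcomp Require Import all_boot all_order all_algebra.
From mathcomp Require Import all_classical all_reals all_analysis.
From mathcomp Require Import ring lra zify.
Import numFieldNormedType.Exports.
Import Order.TTheory GRing.Theory Num.Theory.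
Local Open Scope ring_scope.
Local Open Scope classical_set_scope.

(** Averaging one leading bit at a time, over plain strings, lets inputs change length without casts
    between tuple types. *)
Fixpoint avg (R : realType) (n : nat) (F : seq bool -> R) : R :=
  if n is n'.+1 then
    (avg R n' (fun u => F (true :: u)) + avg R n' (fun u => F (false :: u))) / 2
  else F [::].
Arguments avg {R} n F.

Lemma avg_tuple (R : realType) (n : nat) (F : seq bool -> R) :
  (\sum_(x : n.-tuple bool) F x) / (2 ^ n)%:R = avg n F.
Proof.
elim: n F => [|n IHn] F /=.
  by rewrite (big_pred1 [tuple]) ?divr1 // => x;
    apply/esym/eqP/val_inj; rewrite (tuple0 x).
rewrite -!IHn (reindex (fun p : bool * n.-tuple bool => [tuple of p.1 :: p.2])) /=.
  rewrite -(pair_bigA _ (fun b (u : n.-tuple bool) => F (b :: u))) /= big_bool.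
  by rewrite expnS natrM [LHS]mulrDl; field; rewrite pnatr_eq0 expn_eq0.
exists (fun x => (thead x, [tuple of behead x])) => [[b u] _|x _] /=.
  by congr pair; apply: val_inj.
by rewrite [RHS]tuple_eta; apply: val_inj.
Qed.

Lemma avg_le (R : realType) (n : nat) (F G : seq bool -> R) :
  (forall u, size u = n -> F u <= G u) -> avg n F <= avg n G.
Proof.
elim: n F G => [|n IHn] F G FG /=; first exact: FG.
by rewrite ler_pM2r ?invr_gt0 // lerD // IHn // => u su; apply: FG; rewrite /= su.
Qed.

Lemma avg_cst (R : realType) (n : nat) (c : R) : avg n (fun=> c) = c.
Proof. by elim: n => //= n ->; field. Qed.

Lemma avgD (R : realType) (n : nat) (F G : seq bool -> R) :
  avg n (fun u => F u + G u) = avg n F + avg n G.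
Proof. by elim: n F G => //= n IHn F G; rewrite !IHn; field. Qed.

Lemma avgMr (R : realType) (n : nat) (c : R) (F : seq bool -> R) :
  avg n (fun u => F u * c) = avg n F * c.
Proof. by elim: n F => //= n IHn F; rewrite !IHn; field. Qed.

Lemma avg_cat (R : realType) (k l : nat) (F : seq bool -> R) :
  avg (k + l) F = avg l (fun v => avg k (fun u => F (u ++ v))).
Proof.
elim: k F => //= k IHk F.
by rewrite avgMr avgD !IHk.
Qed.

Lemma avg_suffix_le (R : realType) (k l : nat) (F : seq bool -> R) (M : R) :
  (forall v, size v = l -> avg k (fun u => F (u ++ v)) <= M) ->
  avg (k + l) F <= M.
Proof. by move=> FM; rewrite avg_cat -[leRHS](avg_cst R l); apply: avg_le. Qed.

(* Each pair survives with probability 1/2 as a uniform bit, so that the pairing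
   of a uniform string is uniform given its length, of mean [m / 2]. *)
Lemma avg_pair_round_le (R : realType) (m : nat) (F : seq bool -> R) (a b : R) :
  (forall j, (j <= m)%N -> avg j F <= a * j%:R + b) ->
  avg m.*2 (fun u => F (pair_round u).1) <= a * (m%:R / 2) + b.
Proof.
elim: m F b => [|m IHm] F b Fab.
  by have := Fab 0%N (leqnn _); rewrite /= mul0r.
(* [G] averages over the four values of the first pair: two keep a bit, two drop it. The first pair
   adds 1/2 to the mean length, hence [b + a / 2] below. *)
pose G u := (F (true :: u) + F (false :: u) + (F u + F u)) * 4^-1.
have -> : avg m.+1.*2 (fun u => F (pair_round u).1) =
          avg m.*2 (fun u => G (pair_round u).1).
  have E c d : (fun u => F (pair_round [:: c, d & u]).1) =
      (fun u => F (if c == d then d :: (pair_round u).1 else (pair_round u).1)).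
    by apply/funext => u /=; case: (pair_round u) => y n /=; case: eqP.
  by rewrite /G avgMr !avgD doubleS; cbn [avg]; rewrite !E /=; field.
have -> : a * (m.+1%:R / 2) + b = a * (m%:R / 2) + (b + a / 2).
  by rewrite -natr1; field.
apply: IHm => j jm; rewrite /G avgMr !avgD.
have := Fab j (leqW jm); have := Fab j.+1 jm; rewrite /= -[j.+1%:R]natr1.
by lra.
Qed.

Lemma pair_round_cat (u t : seq bool) : ~~ odd (size u) ->
  (pair_round (u ++ t)).1 = (pair_round u).1 ++ (pair_round t).1.
Proof.
have [m] := ubnP (size u); elim: m u => // m IHm [|a [|b u]] //= ltm.
rewrite negbK => /IHm; case: (pair_round (u ++ t)) => y c /=.
by case: (pair_round u) => z d /= ->; [case: eqP | rewrite -ltnS ltnW].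
Qed.

Lemma comparisons_round (x : seq bool) : (3 < size x)%N ->
  comparisons x = ((size x)./2 + comparisons
    (if odd (size x)./2 then (pair_round x).1
     else rcons (pair_round x).1 (last false x)))%N.
Proof.
move=> x4; rewrite /comparisons tournamentE // -pair_round_count.
by case: (pair_round x) => y c /=; case: (tournament _).
Qed.

Lemma comparisons_small (x : seq bool) : (size x <= 3)%N -> (comparisons x <= 1)%N.
Proof. by case: x => [|a [|b [|c [|d x]]]]. Qed.

(** No pair straddles [u] and [t], and [t] nonempty contains the last bit; so [t'] is chosen before
    [u]. *)
Lemma comparisons_cat_le (m : nat) (t : seq bool) :
  (0 < size t <= 3)%N -> (3 < m.*2 + size t)%N ->
  exists2 t', (size t' <= 2)%N & forall u, size u = m.*2 ->
    (comparisons (u ++ t) <=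
     m.+1 + comparisons ((pair_round u).1 ++ t'))%N.
Proof.
move=> /andP[t0 t3] mt.
exists (if odd (m.*2 + size t)./2 then (pair_round t).1
        else rcons (pair_round t).1 (last false t)).
  have := pair_round_size t; case: ifP => _; rewrite ?size_rcons; lia.
move=> u um; rewrite comparisons_round size_cat um //.
rewrite pair_round_cat ?um ?odd_double //.
have -> : last false (u ++ t) = last false t.
  by rewrite last_cat; case: t t0 {t3 mt}.
by case: ifP => _; rewrite ?rcons_cat leq_add2r; lia.
Qed.

(** The right side is the tangent at [x = s ^+ 2 / 4]; the gap is a square over [2 * s]. *)
Lemma sqrt_tangent (R : realType) (s x : R) : 0 < s -> 0 <= x ->
  2 * Num.sqrt x <= 2 / s * x + s / 2.
Proof.
move=> s0 x0; rewrite -{2}[x]sqr_sqrtr //; set q := Num.sqrt _.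
rewrite -subr_ge0.
have -> : 2 / s * q ^+ 2 + s / 2 - 2 * q = (2 * q - s) ^+ 2 / (2 * s).
  by field; rewrite gt_eqF.
by rewrite divr_ge0 ?sqr_ge0 // mulr_ge0 // ltW.
Qed.

(* In a recursive call the last bits need not be uniform: for [n] divisible by 4,
   [x_n] may be appended twice. The recursion however preserves the shape
   "uniform prefix followed by at most two arbitrary bits". *)
Lemma avg_comparisons_cat_le (R : realType) (n : nat) (t : seq bool) :
  (size t <= 2)%N ->
  avg n (fun u => (comparisons (u ++ t))%:R) <=
    2 * n%:R / 3 + 2 * Num.sqrt n%:R + 1 :> R.
Proof.
have [k] := ubnP n; elim: k n t => // k IHk n t nk t2.
have [nt3|nt4] := leqP (n + size t) 3.
  apply: (@le_trans _ _ 1).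
    rewrite -[leRHS](avg_cst R n); apply: avg_le => u su.
    by rewrite (ler_nat R _ 1) comparisons_small // size_cat su.
  by rewrite lerDr addr_ge0 ?mulr_ge0 ?sqrtr_ge0.
(* If [t] is empty, freezing two uniform bits makes the suffix nonempty and shortens the prefix. *)
have [/size0nil t0|t0] := posnP (size t).
  rewrite t0 /= addn0 in nt4; have -> : n = (n - 2 + 2)%N by lia.
  apply: avg_suffix_le => v v2; rewrite t0.
  under eq_fun do rewrite cats0.
  apply: le_trans (IHk (n - 2)%N v _ _) _; [by lia | by rewrite v2 |].
  have n2 : (n - 2)%:R <= (n - 2 + 2)%:R :> R by rewrite ler_nat leq_addr.
  have := n2; rewrite -(ler_sqrt _ (ler0n R _)).
  by lra.
(* For odd [n], one uniform bit moves to the suffix, which then has at most three bits. *)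
pose m := n./2; have nE : n = (m.*2 + odd n)%N by rewrite addnC odd_double_half.
rewrite [X in avg X]nE; apply: avg_suffix_le => v vn.
under eq_fun do rewrite -catA.
have [||t' t'2 cle] := comparisons_cat_le m (v ++ t).
- by rewrite size_cat vn; case: (odd n); lia.
- by rewrite size_cat vn addnA -nE.
have m0 : (0 < m)%N by lia.
have n1 : 1 <= n%:R :> R by rewrite ler1n; lia.
set s : R := Num.sqrt n%:R.
have s1 : 1 <= s by rewrite -sqrtr1 ler_wsqrtr.
have ss : s * s = n%:R by rewrite -expr2 sqr_sqrtr.
apply: (@le_trans _ _ (avg m.*2 (fun u =>
    m.+1%:R + (comparisons ((pair_round u).1 ++ t'))%:R))).
  by apply: avg_le => u um; rewrite -natrD ler_nat cle.
rewrite avgD avg_cst.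
have jle j : (j <= m)%N -> avg j (fun y => (comparisons (y ++ t'))%:R) <=
    (2 / 3 + 2 / s) * j%:R + (s / 2 + 1).
  move=> jm; apply: le_trans (IHk j t' _ t'2) _; first by lia.
  by have := sqrt_tangent R s j%:R (lt_le_trans ltr01 s1) (ler0n R j); lra.
apply: (le_trans (lerD (lexx _) (avg_pair_round_le _ _ _ _ _ jle))).
have mn : 2 * m%:R <= n%:R :> R by rewrite -natrM ler_nat mul2n; lia.
have ms : m%:R / s <= s / 2.
  by rewrite ler_pdivrMr ?(lt_le_trans ltr01 s1) //; lra.
(* The total is [4 * m / 3 + m / s + s / 2 + 2], at most [2 * n / 3 + s + 2]; then [1 <= s]
   concludes. *)
rewrite -[m.+1%:R]natr1; lra.
Qed.

Theorem theorem4 (R : realType) :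
  exists f : nat -> R,
    f =O_\oo (fun n : nat => Num.sqrt (n%:R * ln n%:R : R)) /\
    forall n : nat, (0 < n)%N ->
      expected_comparisons R n <= 2 * n%:R / 3 + f n.
Proof.
exists (fun n => 2 * Num.sqrt n%:R + 1); split; last first.
  move=> n _; rewrite addrA /expected_comparisons.
  rewrite (avg_tuple R n (fun x => (comparisons x)%:R)).
  apply: le_trans (avg_comparisons_cat_le R n [::] isT).
  by apply: avg_le => u _; rewrite cats0.
(* Once [n] exceeds e, both 1 and [sqrt n] are at most [sqrt (n * ln n)], whence the constant 3. *)
apply/eqO_exP; exists 3 => //; near=> n.
have n1 : (1 : R) <= n%:R by near: n; exact: nbhs_infty_ger.
have ln1 : (1 : R) <= ln n%:R.
  rewrite -[leLHS]expRK ler_ln ?posrE ?expR_gt0 //; last exact: lt_le_trans n1.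
  by near: n; exact: nbhs_infty_ger.
have s1 : 1 <= Num.sqrt n%:R :> R by rewrite -[leLHS]sqrtr1 ler_wsqrtr.
have sn : Num.sqrt n%:R <= Num.sqrt (n%:R * ln n%:R) :> R.
  by rewrite ler_wsqrtr // ler_peMr.
by rewrite !ger0_norm ?sqrtr_ge0 //; lra.
Unshelve. all: by end_near.
Qed.
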